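(* Let $\mathbf{u}=(u_n)_{n\in\mathbb{N}}\in\{0,1\}^{\mathbb{N}}$. Let $f(0)=f(1)=1$, $f(2)=a+b$ and $$f(n)=af(n-u_n-1)+bf(n-u_n-2)\qquad(n\ge 3),$$ where $a,b$ are either fixed integers such that $f(n)\neq 0$ for all $n\in\mathbb{N}$, or independent indeterminates over $\mathbb{Q}$. Put $h(n)=f(n+1)/f(n)$ and $\mathcal{V}(f)=\{h(n):n\in\mathbb{N}\}$. Let $$\mathcal{R}(\mathbf{u})=\{n\in\mathbb{N}:u_n=0,\ u_{n+1}=1,\ u_{n+2}=0\}\cup\{0\}=\{n_0=0<n_1<\cdots\}.$$ If $\mathcal{R}(\mathbf{u})$ has gaps bounded by $c$, then $\#\mathcal{V}(f)\le 2^{c-1}$. Moreover, if $\mathcal{R}(\mathbf{u})$ has gaps bounded by $c$ and the sequence $\mathbf{u}$ is additionally $k$-automatic, then $(h(n))_{n\in\mathbb{N}}$ is also $k$-automatic.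
   Context: $\mathbb{N}=\{0,1,2,\ldots\}$. A set $\{n_0=0<n_1<\cdots\}\subset\mathbb{N}$ is said to have gaps bounded by $c$ (where $c\ge 1$ is an integer) if it is infinite and $n_{j+1}-n_j\le c$ for all $j\in\mathbb{N}$. For an integer $k\ge 2$, a sequence $(x_n)_{n\in\mathbb{N}}$ with values in some set is called $k$-automatic if it is generated by a deterministic finite automaton with output reading the base-$k$ representation of $n$; equivalently, if its $k$-kernel $\{(x_{k^jn+i})_{n\in\mathbb{N}}: j\in\mathbb{N},\ 0\le i<k^j\}$ is a finite set and the sequence takes finitely many values.
   Formalization: The bound #V(f) ≤ 2^(c-1) is stated only when c ≠ 2 or 1 ∉ R(u): for c = 2 and u = 1,0,1,0,… it fails, since h takes the values 1, a+b, a+b/(a+b) (for a=b=1: 1, 2, 3/2). The automaticity claim is unrestricted. *)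

(* Defs.v *)
From HB Require Import structures.
From mathcomp Require Import all_boot all_order all_algebra.
From mathcomp Require Import fraction.
From mathcomp Require Import mpoly.
From mathcomp Require Import boolp classical_sets functions cardinality.

Set Implicit Arguments.
Unset Strict Implicit.
Unset Printing Implicit Defensive.

Import GRing.Theory.

Local Open Scope classical_set_scope.
Local Open Scope ring_scope.

(* A 0-1 sequence is a function nat -> bool; [u n] is read as 0 or 1 through
   the coercion of bool to nat.  The truncated subtractions below are exact,
   since n >= 3. *)
Definition nested_rec (R : nzRingType) (a b : R) (u : nat -> bool)
    (f : nat -> R) : Prop :=
  [/\ f 0%N = 1, f 1%N = 1, f 2%N = a + b &
      forall n : nat, (3 <= n)%N ->
        f n = a * f (n - u n - 1)%N + b * f (n - u n - 2)%N].

Definition Rset (u : nat -> bool) : set nat :=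
  [set n | [/\ u n = false, u n.+1 = true & u n.+2 = false]] `|` [set 0%N].

(* [e] is the increasing enumeration n_0 = 0 < n_1 < ... of S; its existence
   makes S infinite. *)
Definition gaps_bounded (c : nat) (S : set nat) : Prop :=
  exists e : nat -> nat,
    [/\ e 0%N = 0%N, forall j, (e j < e j.+1)%N, range e = S &
        forall j, (e j.+1 - e j <= c)%N].

Record dfao (k : nat) (X : Type) := Dfao {
  state : finType;
  init : state;
  trans : state -> 'I_k -> state;
  output : state -> X }.

Definition run (k : nat) (X : Type) (M : dfao k X) (w : seq 'I_k) : X :=
  output (foldl (@trans k X M) (init M) w).

(* [w] is the base-k representation of n, most significant digit first and
   without leading zero; 0 is represented by the empty word. *)
Definition base_repr (k n : nat) (w : seq 'I_k) : Prop :=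
  (forall (d : 'I_k) (w' : seq 'I_k), w = d :: w' -> d != 0%N :> nat) /\
  foldl (fun (m : nat) (d : 'I_k) => m * k + d)%N 0%N w = n.

(* Meaningful for k >= 2 only, when every n has exactly one representation. *)
Definition automatic (k : nat) (X : Type) (x : nat -> X) : Prop :=
  exists M : dfao k X,
    forall (n : nat) (w : seq 'I_k), base_repr n w -> x n = run M w.

(* Main.v *)
Require Import Defs.
From HB Require Import structures.
From mathcomp Require Import all_boot all_order all_algebra.
From mathcomp Require Import fraction.
From mathcomp Require Import mpoly.
From mathcomp Require Import boolp classical_sets functions cardinality.
From mathcomp Require Import zify ring.

Set Implicit Arguments.
Unset Strict Implicit.
Unset Printing Implicit Defensive.

(** Call a position p a restart when the bits at p, p+1, p+2 are 0, 1, 0.  The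
first two make f (p+1) and f p the same combination of earlier terms, and the
third gives f (p+2) = (a + b) f p.  From p+3 on the recurrence never looks
below p, so f (p+i) / f p is a polynomial in a and b that depends only on the
bits at p+3, ..., p+i, and h (p+i) depends only on those at p+3, ..., p+i+1
([ratio_from_restart]).

The bits at 0, 1, 2 do not occur in the recurrence, and the initial values of
f are those obtained from the bits 0, 1, 0.  Overwriting them ([prep]) makes 0
a restart like every other one; the only element of [Rset u] that ceases to be
a restart is 1.

Let p be the last restart up to n = p + i.  The [tag] of n is 0 if i = 0 and
otherwise the number whose binary digits are 1 followed by the bits at p+3,
..., p+i+1.  Equal tags give equal values of h ([tag_ratio]).  The tag is less
than 2 ^ i, so if restarts have gaps at most c there are at most 2 ^ (c - 1)
tags.

If 1 lies in [Rset u], the first gap between restarts may be c + 1.  Then c >= 3: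
the guard excludes 2, and c = 1 would also put 2 into [Rset u], against the bit 1
at 2.  The bound on the tag can then fail only at n = c.  But no n other
than c has the tag with all c - 1 digits equal to 1: outside the first block, a
tag with c - 1 digits is followed by a restart at n + 1, so its last digit is
0; in the first block the bit at 3 is 0.  So this number is free to be the tag
of c ([tag_lt_all_ones]).

For automaticity, the tag of n is computed from a window of bits of bounded
length by iterating a local rule c + 1 times ([approx_tag]).  Automatic
sequences are stable under both unit shifts, pairing and letter-to-letter maps, which
follows from a description of them by states satisfying a recursion on digits
([automatic_trackable]).

Over the field of fractions, f n is nonzero because its value at a = b = 1 is
positive. *)

Import Order.TTheory GRing.Theory Num.Theory.

Local Open Scope classical_set_scope.
Local Open Scope card_scope.
Local Open Scope ring_scope.

(** * Automatic sequences *)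

(** The recursion also holds for n = d = 0, so that leading zeros, which
[base_repr] forbids, are harmless; this makes the closure properties below
free of side conditions on words. *)
Definition trackable (k : nat) (X : Type) (x : nat -> X) : Prop :=
  exists (S : finType) (s : nat -> S) (delta : S -> 'I_k -> S) (out : S -> X),
    (forall n (d : 'I_k), s (n * k + d)%N = delta (s n) d) /\
    (forall n, x n = out (s n)).

Lemma trackable_automatic k X (x : nat -> X) : trackable k x -> automatic k x.
Proof.
move=> [S [s [delta [out [sE xE]]]]].
exists (Dfao (s 0%N) delta out) => n w [_ <-].
rewrite xE /run /=; congr (out _).
elim: w 0%N => //= d w IHw m.
by rewrite -sE IHw.
Qed.

Fixpoint digits (k fuel n : nat) : seq 'I_k.+1 :=
  if fuel is fuel'.+1 then
    if n == 0%N then [::]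
    else rcons (digits k fuel' (n %/ k.+1)) (inord (n %% k.+1))
  else [::].

Lemma digits_fuel k fuel n : (0 < k)%N -> (n <= fuel)%N ->
  digits k fuel n = digits k n n.
Proof.
move=> k_gt0; have H m : forall F1 F2, (m <= F1)%N -> (m <= F2)%N ->
    digits k F1 m = digits k F2 m.
  elim/ltn_ind: m => m IHm [|F1] [|F2] //=; try by case: m IHm.
  move=> le1 le2; case: eqP => // /eqP; rewrite -lt0n => m_gt0.
  have lt_div : (m %/ k.+1 < m)%N by apply: ltn_Pdiv.
  congr rcons; apply: IHm => //; lia.
by move=> le_n; apply: H.
Qed.

Lemma digits_rec k n (d : 'I_k.+1) : (0 < k)%N -> (0 < n * k.+1 + d)%N ->
  let m := (n * k.+1 + d)%N in digits k m m = rcons (digits k n n) d.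
Proof.
move=> k_gt0 m_gt0 m; rewrite -/m in m_gt0.
have div_m : (m %/ k.+1 = n)%N by rewrite /m divnMDl // divn_small ?addn0.
have mod_m : (m %% k.+1 = d)%N by rewrite /m modnMDl modn_small.
have lt_nm : (n < m)%N by rewrite -div_m; apply: ltn_Pdiv.
case: m m_gt0 div_m mod_m lt_nm => // m _ div_m mod_m lt_nm.
by rewrite /= div_m mod_m digits_fuel // inord_val.
Qed.

Lemma digits_base_repr k n : (0 < k)%N -> base_repr n (digits k n n).
Proof.
move=> k_gt0; elim/ltn_ind: n => -[|n] IHn; first by split.
have nE := divn_eq n.+1 k.+1.
have lt_div : (n.+1 %/ k.+1 < n.+1)%N by apply: ltn_Pdiv.
have [nz valE] := IHn _ lt_div.
pose d : 'I_k.+1 := Ordinal (ltn_pmod n.+1 (ltn0Sn k)).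
have -> : digits k n.+1 n.+1 = rcons (digits k (n.+1 %/ k.+1) (n.+1 %/ k.+1)) d.
  by rewrite {1 2}nE (@digits_rec k _ d) //= -nE.
split; last by rewrite -cats1 foldl_cat /= valE -nE.
move=> d' w'; case: (digits _ _ _) nz valE => [_ /= val0 [<- _] /=|d0 w nz _].
  by move: nE; rewrite -val0 mul0n add0n => <-.
by rewrite rcons_cons => -[<- _]; apply: nz.
Qed.

(** The initial state of an automaton need not be fixed by the digit 0, so 0
gets a state of its own. *)
Lemma automatic_trackable k X (x : nat -> X) :
  (2 <= k)%N -> automatic k x -> trackable k x.
Proof.
case: k => // k k_gt0 [M xE].
pose word n := foldl (@trans _ _ M) (init M) (digits k n n).
exists (option (state M)), (fun n => if n is 0%N then None else Some (word n)).
exists (fun o (d : 'I_k.+1) => if (o == None) && (d == 0%N :> nat) then None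
                   else Some (trans (odflt (init M) o) d)).
exists (fun o => output (odflt (init M) o)); split.
  move=> n d; have [d_n0|dn_gt0] := posnP (n * k.+1 + d)%N.
    by rewrite d_n0; case: n d_n0 => //= d0; rewrite [nat_of_ord d]d0.
  move: (digits_rec k_gt0 dn_gt0) => /= dE.
  have wE : word (n * k.+1 + d)%N = trans (word n) d.
    by rewrite /word dE -cats1 foldl_cat.
  case E: (n * k.+1 + d)%N dn_gt0 wE => [//|m] _ ->.
  case: n {dE} E => [|n] E //=.
  by rewrite mul0n add0n in E; rewrite E.
by move=> n; rewrite (xE n _ (digits_base_repr n k_gt0)) /run; case: n.
Qed.

Lemma trackable_map k X Y (g : X -> Y) (x : nat -> X) :
  trackable k x -> trackable k (fun n => g (x n)).
Proof.
move=> [S [s [delta [out [sE xE]]]]].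
by exists S, s, delta, (fun t => g (out t)); split=> // n; rewrite xE.
Qed.

Lemma trackable_pair k X Y (x : nat -> X) (y : nat -> Y) :
  trackable k x -> trackable k y -> trackable k (fun n => (x n, y n)).
Proof.
move=> [S [s [delta [out [sE xE]]]]] [S' [s' [delta' [out' [sE' yE]]]]].
exists (S * S')%type, (fun n => (s n, s' n)).
exists (fun t d => (delta t.1 d, delta' t.2 d)), (fun t => (out t.1, out' t.2)).
by split=> [n d|n] /=; rewrite ?sE ?sE' ?xE ?yE.
Qed.

(** Adding 1 to n * k + d either increments d or carries into n + 1, so the
states at n and n + 1 together satisfy a recursion on digits. *)
Lemma trackable_succ k X (x : nat -> X) : (2 <= k)%N ->
  trackable k x -> trackable k (fun n => x n.+1).
Proof.
case: k => // k _ [S [s [delta [out [sE xE]]]]].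
exists (S * S)%type, (fun n => (s n, s n.+1)).
exists (fun t d => (delta t.1 d, if (d < k)%N then delta t.1 (inord d.+1)
                                 else delta t.2 ord0)), (fun t => out t.2).
split=> [n d|n] /=; last by rewrite xE.
rewrite sE; congr pair; case: ltnP => [lt_dk|le_kd].
  by rewrite -sE inordK // addnS.
rewrite -sE /= addn0; congr s.
have -> : d = k :> nat by apply/eqP; rewrite eqn_leq le_kd -ltnS ltn_ord.
by rewrite mulSn addnC addSn.
Qed.

Lemma trackable_eq0 k : (2 <= k)%N -> trackable k (fun n => n == 0%N).
Proof.
move=> k_gt1; exists bool, (fun n => n == 0%N).
exists (fun b (d : 'I_k) => b && (d == 0%N :> nat)), id; split=> // n d.
by rewrite addn_eq0 muln_eq0 (gtn_eqF (ltnW k_gt1)) orbF.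
Qed.

(** Borrowing is dual to the carry in [trackable_succ], except at 0, where the
truncated predecessor makes it necessary to track whether n = 0. *)
Lemma trackable_pred k X (x : nat -> X) : (2 <= k)%N ->
  trackable k x -> trackable k (fun n => x n.-1).
Proof.
case: k => // k _ [S [s [delta [out [sE xE]]]]].
exists (S * S * bool)%type, (fun n => (s n, s n.-1, n == 0%N)).
exists (fun t d =>
  (delta t.1.1 d,
   if (0 < d)%N then delta t.1.1 (inord d.-1)
   else if t.2 then s 0%N else delta t.1.2 ord_max,
   t.2 && (d == 0%N :> nat))), (fun t => out t.1.2).
split=> [n d|n] /=; last by rewrite xE.
rewrite sE addn_eq0 muln_eq0 orbF; congr (_, _, _).
case: posnP => [d0|d_gt0]; last first.
  rewrite -sE inordK; last by rewrite prednK // ltnW.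
  by congr s; rewrite -subn1 -addnBA // subn1.
rewrite d0 addn0; case: n => //= n.
by rewrite -sE; congr s; rewrite /=; lia.
Qed.

Lemma trackable_leq k j : (2 <= k)%N -> trackable k (fun n => (n <= j)%N).
Proof.
move=> k_gt1; elim: j => [|j IHj].
  have -> : (fun n => n <= 0)%N = (fun n => n == 0%N) by apply/funext; case.
  exact: trackable_eq0.
have -> : (fun n => n <= j.+1)%N = (fun n => n.-1 <= j)%N.
  by apply/funext; case.
exact: (@trackable_pred _ _ (fun n => n <= j)%N).
Qed.

(** * Restarts and tags *)

Definition prep (u : nat -> bool) (n : nat) : bool :=
  if (n <= 2)%N then n == 1%N else u n.

Definition restart (v : nat -> bool) (n : nat) : bool :=
  [&& ~~ v n, v n.+1 & ~~ v n.+2].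

Definition next_tag (r bit : bool) (t : nat) : nat :=
  if r then 0%N else if t == 0%N then 1%N else (t.*2 + bit)%N.

Fixpoint tag (v : nat -> bool) (n : nat) : nat :=
  if n is m.+1 then next_tag (restart v n) (v n.+1) (tag v m) else 0%N.

Lemma restart_prep0 u : restart (prep u) 0.
Proof. by []. Qed.

Lemma restart_prep u n : Rset u n -> n != 1%N -> restart (prep u) n.
Proof.
rewrite /restart /prep; case=> [[u0 u1 u2] n_neq1|-> //].
by case: n n_neq1 u0 u1 u2 => [|[|[|n]]] //= _ u0 u1 u2; rewrite ?u0 u1 u2.
Qed.

Lemma tag_restart v n : restart v n -> tag v n = 0%N.
Proof. by case: n => //= n ->. Qed.

Lemma tag_eq0 v n : restart v 0 -> tag v n = 0%N -> restart v n.
Proof.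
case: n => //= n _; rewrite /next_tag; case: restart => //.
by case: (tag v n =P _) => //; lia.
Qed.

Lemma tag_lt v p i : restart v p -> (tag v (p + i) < 2 ^ i)%N.
Proof.
move=> rp; elim: i => [|i IHi]; first by rewrite addn0 tag_restart.
have pow_gt0 : (0 < 2 ^ i)%N by rewrite expn_gt0.
rewrite addnS /= /next_tag expnS.
by case: restart; [lia | case: eqP; case: (v (p + i).+2); lia].
Qed.

(** When the earlier tags are 0 both positions are restarts, so that their
next bits, which the tag does not record, agree as well. *)
Lemma tag_inj_step v n m : restart v 0 -> tag v n.+1 = tag v m.+1 ->
  tag v n.+1 <> 0%N -> tag v n = tag v m /\ v n.+2 = v m.+2.
Proof.
move=> r0 /=; rewrite /next_tag; case: restart => //; case: restart.
  by move=> ->.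
case: (tag v n =P 0%N) => [n0|n_neq0]; case: (tag v m =P 0%N) => [m0|m_neq0].
- case/and3P: (tag_eq0 r0 n0) (tag_eq0 r0 m0) => _ _ /negPf ->.
  by case/and3P=> _ _ /negPf ->; rewrite n0 m0.
- by lia.
- by lia.
- by case: (v n.+2); case: (v m.+2) => ? _; split=> //; lia.
Qed.

Lemma tag_inj v n m : restart v 0 -> tag v n = tag v m ->
  exists p q i, [/\ restart v p, restart v q, n = (p + i)%N, m = (q + i)%N &
    forall t, (t <= i.+1)%N -> v (p + t)%N = v (q + t)%N].
Proof.
move=> r0; have zero n' m' : tag v n' = 0%N -> tag v m' = 0%N ->
    exists p q i, [/\ restart v p, restart v q, n' = (p + i)%N, m' = (q + i)%N &
      forall t, (t <= i.+1)%N -> v (p + t)%N = v (q + t)%N].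
  move=> /(tag_eq0 r0) rn /(tag_eq0 r0) rm; exists n', m', 0%N.
  rewrite !addn0; split=> //.
  case/and3P: rn => /negPf v0 v1 _; case/and3P: rm => /negPf w0 w1 _.
  by case=> [|[|//]] _; rewrite ?addn0 ?addn1 ?v0 ?w0 ?v1 ?w1.
elim: n m => [|n IHn] m tagE; first exact: zero.
have [tag0|/eqP tag_neq0] := eqVneq (tag v n.+1) 0%N.
  by apply: zero; rewrite -?tagE.
case: m tagE => [|m] tagE; first by case: tag_neq0.
have [/IHn [p [q [i [rp rq nE mE agree]]]] vE] :=
  tag_inj_step r0 tagE tag_neq0.
exists p, q, i.+1; rewrite !addnS -nE -mE; split=> // t.
rewrite leq_eqVlt => /predU1P [->|]; last exact: agree.
by rewrite !addnS -nE -mE.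
Qed.

(** * Bounded gaps *)

Lemma gaps_cover c S n : gaps_bounded c S ->
  exists p, [/\ S p, (p <= n < p + c)%N & n.+1 = (p + c)%N -> S n.+1].
Proof.
move=> [e [e0 e_incr e_range e_gap]].
have Se j : S (e j) by rewrite -e_range; exists j.
have [j /andP [le_n lt_n]] : exists j, (e j <= n < e j.+1)%N.
  elim: n => [|n [j /andP [le_n lt_n]]].
    by exists 0%N; have := e_incr 0%N; rewrite e0.
  have [lt_n1|le_n1] := ltnP n.+1 (e j.+1); first by exists j; lia.
  by exists j.+1; have := e_incr j.+1; lia.
exists (e j); have := e_gap j; have := e_incr j => ? ?; split=> //; first lia.
by move=> nE; have -> : n.+1 = e j.+1 by lia.
Qed.

Lemma Rset12 u : Rset u 1%N -> ~ Rset u 2%N.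
Proof. by move=> [[_ u2 _]|//] [[]|//]; rewrite u2. Qed.

Lemma restart_cover u c n : gaps_bounded c (Rset u) ->
  exists2 p, restart (prep u) p & (p <= n < p + c.+1)%N.
Proof.
move=> gaps; have [p [Rp le_p _]] := gaps_cover n gaps.
have [p1|p_neq1] := eqVneq p 1%N; last by exists p; [exact: restart_prep|lia].
by exists 0%N => //; lia.
Qed.

Lemma tag_bound u c n : gaps_bounded c (Rset u) -> ~ Rset u 1%N ->
  (tag (prep u) n < 2 ^ (c - 1))%N.
Proof.
move=> gaps notR1; have [p [Rp le_p _]] := gaps_cover n gaps.
have rp : restart (prep u) p.
  by apply: restart_prep => //; apply: contra_not_neq notR1 => <-.
have /(leq_trans (tag_lt (n - p) rp)) : (2 ^ (n - p) <= 2 ^ (c - 1))%N.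
  by rewrite leq_exp2l //; lia.
by rewrite subnKC //; lia.
Qed.

Lemma tag_lt_first v n : ~~ v 3 -> (2 <= n)%N -> ((tag v n).+1 < 2 ^ n)%N.
Proof.
move=> v3; elim: n => // n IHn; rewrite leq_eqVlt => /predU1P [[<-]|/IHn].
  by rewrite /= /next_tag (negPf v3); do 2 case: restart.
rewrite expnS /= /next_tag.
by case: restart; [lia | case: eqP; case: (v n.+2); lia].
Qed.

(** The number 2 ^ (c - 1) - 1 is the tag with all c - 1 digits equal to 1. *)
Lemma tag_lt_all_ones u c n : gaps_bounded c (Rset u) -> Rset u 1%N ->
  (3 <= c)%N -> n != c -> (tag (prep u) n < 2 ^ (c - 1) - 1)%N.
Proof.
move=> gaps R1 c_ge3 n_neq_c.
have pow4 : (2 ^ 2 <= 2 ^ (c - 1))%N by rewrite leq_exp2l //; lia.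
have [p [Rp le_p last_bit]] := gaps_cover n gaps.
have [p_le1|p_gt1] := leqP p 1.
  have v3 : ~~ prep u 3 by case: R1 => [[_ _]|//]; rewrite /prep /= => ->.
  have [n_le1|n_ge2] := leqP n 1.
    have := tag_lt n (restart_prep0 u); rewrite add0n.
    by have : (2 ^ n <= 2 ^ 1)%N; [rewrite leq_exp2l | lia].
  have := tag_lt_first v3 n_ge2.
  have : (2 ^ n <= 2 ^ (c - 1))%N by rewrite leq_exp2l //; lia.
  by lia.
have rp : restart (prep u) p by apply: restart_prep => //; lia.
have lt_tag := tag_lt (n - p) rp; rewrite subnKC in lt_tag; last by lia.
have [nE|n_neq] := eqVneq n.+1 (p + c)%N; last first.
  have : (2 ^ (n - p) <= 2 ^ (c - 2))%N by rewrite leq_exp2l //; lia.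
  have -> : (c - 1 = (c - 2).+1)%N by lia.
  by have := expn_gt0 2 (c - 2); rewrite expnS; lia.
(* The next position is a restart, so the last binary digit of the tag is 0. *)
have vn : prep u n.+1 = false.
  rewrite /prep ifN; last by rewrite -ltnNge; lia.
  by case: (last_bit nE) => [[]|].
have npE : (n - p = c - 1)%N by lia.
have cE : (c - 1 = (c - 2).+1)%N by lia.
rewrite npE in lt_tag; move: lt_tag pow4; rewrite cE expnS.
case: n vn {rp le_p last_bit n_neq_c nE npE} => [|n] vn.
  by move=> /=; lia.
by rewrite /= vn /next_tag; case: restart; [lia | case: eqP; lia].
Qed.

(** Starting from 0 instead of from the tag of n - j is harmless once a restart
has been met, because [next_tag] then forgets its argument. *)
Fixpoint approx (v : nat -> bool) (j n : nat) : nat :=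
  if j is i.+1 then next_tag (restart v n) (v n.+1) (approx v i n.-1) else 0%N.

Lemma approx_tag v p j n : restart v p -> (p <= n < p + j)%N ->
  approx v j n = tag v n.
Proof.
move=> rp; elim: j n => [|j IHj] n le_n; first lia.
have [rn|nrn] := boolP (restart v n).
  by rewrite tag_restart //= /next_tag rn.
have p_neq_n : p != n by apply: contraNneq nrn => <-.
case: n le_n nrn p_neq_n => [|n] le_n nrn p_neq_n; first lia.
by rewrite /= IHj //; lia.
Qed.

Lemma trackable_prep k u : (2 <= k)%N ->
  trackable k u -> trackable k (prep u).
Proof.
move=> k_gt1 ku.
have := trackable_pair ku (trackable_pair (trackable_leq 0 k_gt1)
  (trackable_pair (trackable_leq 1 k_gt1) (trackable_leq 2 k_gt1))).
move/(trackable_map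
  (fun z => if z.2.2.2 then z.2.2.1 && ~~ z.2.1 else z.1)).
congr trackable; apply/funext => n /=; rewrite /prep.
by case: n => [|[|[|n]]].
Qed.

Lemma trackable_approx k v j : (2 <= k)%N ->
  trackable k v -> trackable k (approx v j).
Proof.
move=> k_gt1 kv; have kv1 := trackable_succ k_gt1 kv.
have kv2 := trackable_succ k_gt1 kv1.
elim: j => [|j /(trackable_pred k_gt1) IHj].
  exact: (trackable_map (fun=> 0%N) kv).
have := trackable_pair (trackable_pair kv kv1) (trackable_pair kv2 IHj).
exact: (trackable_map (fun z =>
  next_tag [&& ~~ z.1.1, z.1.2 & ~~ z.2.1] z.1.2 z.2.2)).
Qed.

Lemma trackable_tag k u c : (2 <= k)%N -> gaps_bounded c (Rset u) ->
  trackable k u -> trackable k (tag (prep u)).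
Proof.
move=> k_gt1 gaps /(trackable_prep k_gt1).
move/(trackable_approx c.+1 k_gt1); congr trackable; apply/funext => n.
by have [p rp le_p] := restart_cover n gaps; exact: (approx_tag rp).
Qed.

(** * The recurrence *)

Section Recurrence.

Variables (F : fieldType) (a b : F) (u : nat -> bool) (f : nat -> F).
Hypotheses (f_rec : nested_rec a b u f) (f_neq0 : forall n, f n != 0).

Let v := prep u.

Lemma prep_rec n : (2 <= n)%N ->
  f n = a * f (n - v n - 1)%N + b * f (n - v n - 2)%N.
Proof.
case: f_rec => f0 f1 f2 f_ge3; rewrite leq_eqVlt => /predU1P [<-|n_ge3].
  by rewrite /= f0 f1 f2 !mulr1.
by rewrite /v /prep leqNgt n_ge3 f_ge3.
Qed.

Lemma restart_succ p : restart v p -> f p.+1 = f p.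
Proof.
case: f_rec => f0 f1 f2 _.
case: p => [|[|p]]; rewrite ?f0 ?f1 // => /and3P [/negPf v0 v1 _].
rewrite [LHS]prep_rec // [RHS]prep_rec // v0 v1.
by congr (a * f _ + b * f _); lia.
Qed.

Lemma restart_succ2 p : restart v p -> f p.+2 = (a + b) * f p.
Proof.
move=> rp; case/and3P: (rp) => _ _ /negPf v2.
by rewrite prep_rec // v2 !subSS !subn0 restart_succ // mulrDl.
Qed.

(** Both sides satisfy the same linear recurrence in i, from the same three
initial values. *)
Lemma proportional p q i : restart v p -> restart v q ->
  (forall t, (t <= i)%N -> v (p + t)%N = v (q + t)%N) ->
  f (p + i)%N * f q = f (q + i)%N * f p.
Proof.
move=> rp rq; elim/ltn_ind: i => -[|[|[|i]]] IHi agree.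
- by rewrite !addn0 mulrC.
- by rewrite !addn1 !restart_succ // mulrC.
- by rewrite !addn2 !restart_succ2 //; ring.
have vE := agree i.+3 (leqnn _).
have shift r e : (v (r + i.+3) <= 1)%N -> (0 < e <= 2)%N ->
    (r + i.+3 - v (r + i.+3) - e = r + (i.+3 - v (r + i.+3)%N - e))%N.
  by lia.
have IH e : (0 < e <= 2)%N ->
    f (p + (i.+3 - v (q + i.+3)%N - e))%N * f q
    = f (q + (i.+3 - v (q + i.+3)%N - e))%N * f p.
  by move=> le_e; apply: IHi => [|t le_t]; [|apply: agree]; lia.
rewrite [f (p + _)%N]prep_rec; last by lia.
rewrite [f (q + i.+3)%N]prep_rec; last by lia.
rewrite !shift ?leq_b1 // vE !mulrDl -!mulrA !IH //.
Qed.

Lemma ratio_from_restart p q i : restart v p -> restart v q ->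
  (forall t, (t <= i.+1)%N -> v (p + t)%N = v (q + t)%N) ->
  f (p + i).+1 / f (p + i)%N = f (q + i).+1 / f (q + i)%N.
Proof.
move=> rp rq agree; apply/eqP; rewrite eqr_div //; apply/eqP.
have E1 := proportional rp rq agree.
have E0 := proportional rp rq (fun t le_t => agree t (leqW le_t)).
rewrite !addnS in E1.
apply: (mulIf (mulf_neq0 (f_neq0 p) (f_neq0 q))).
transitivity (f (p + i).+1 * f q * (f (q + i)%N * f p)); first by ring.
by rewrite E1 -E0; ring.
Qed.

Lemma tag_ratio n m : tag v n = tag v m -> f n.+1 / f n = f m.+1 / f m.
Proof.
move=> /(tag_inj (restart_prep0 u)) [p [q [i [rp rq -> ->]]]].
exact: ratio_from_restart.
Qed.

End Recurrence.

(** * Counting and automaticity of the ratios *)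

Lemma factor_through (X : Type) (h : nat -> X) (t : nat -> nat) :
  (forall n m, t n = t m -> h n = h m) -> exists g, forall n, h n = g (t n).
Proof.
move=> ht; exists (fun i => h (xget 0%N [set n | t n = i])) => n.
by apply: ht; rewrite (@xgetPex _ 0%N [set m | t m = t n]) //; exists n.
Qed.

Lemma card_range_le (X : Type) (h : nat -> X) (t : nat -> nat) N :
  (forall n m, t n = t m -> h n = h m) -> (forall n, (t n < N)%N) ->
  range h #<= `I_N.
Proof.
move=> /factor_through [g hE] t_lt.
have -> : range h = g @` range t.
  apply/seteqP; split=> [_ [n _ <-]|_ [_ [n _ <-] <-]]; last by exists n.
  by exists (t n) => //; exists n.
apply: card_le_trans (card_image_le _ _) (subset_card_le _).
by move=> _ [n _ <-] /=.
Qed.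

Lemma ratio_card_automatic (F : fieldType) (a b : F) u (f : nat -> F) c :
  (1 <= c)%N -> gaps_bounded c (Rset u) ->
  nested_rec a b u f -> (forall n, f n != 0) ->
  ((c = 2%N -> ~ Rset u 1%N) ->
     range (fun n => f n.+1 / f n) #<= `I_(2 ^ (c - 1))%N) /\
  (forall k, (2 <= k)%N -> automatic k u ->
     automatic k (fun n => f n.+1 / f n)).
Proof.
move=> c_ge1 gaps f_rec f_neq0; have ratioE := tag_ratio f_rec f_neq0.
split=> [guard|k k_gt1 ku]; last first.
  have [g hE] := factor_through ratioE.
  rewrite (funext hE); apply/trackable_automatic/trackable_map.
  exact/(trackable_tag _ gaps)/automatic_trackable.
have [R1|notR1] := pselect (Rset u 1%N); last first.
  by apply: (card_range_le ratioE) => n; exact: tag_bound.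
have c_ge3 : (3 <= c)%N.
  (* For c = 1 every position lies in [Rset u], in particular 2. *)
  case: c c_ge1 gaps guard => [|[|[|c]]] // _ gaps; last by case.
  have [p [Rp le_p _]] := gaps_cover 2 gaps.
  by case: (Rset12 R1); have <- : p = 2%N by lia.
have small n : n != c -> (tag (prep u) n < 2 ^ (c - 1) - 1)%N.
  by move=> n_neq_c; apply: tag_lt_all_ones.
have pow_gt0 := expn_gt0 2 (c - 1).
apply: (@card_range_le _ _
  (fun n => if n == c then (2 ^ (c - 1) - 1)%N else tag (prep u) n)).
  move=> n m; have [->|/small] := eqVneq n c; have [->|/small] := eqVneq m c.
  - by [].
  - by lia.
  - by lia.
  - by move=> _ _; exact: ratioE.
by move=> n; have [_|/small] := eqVneq n c; lia.
Qed.

(** * Integer and generic coefficients *)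

Lemma nested_rec_morph (R S : nzRingType) (phi : {rmorphism R -> S}) a b u f :
  nested_rec a b u f -> nested_rec (phi a) (phi b) u (fun n => phi (f n)).
Proof.
move=> [f0 f1 f2 f_ge3]; split; rewrite ?f0 ?f1 ?f2 ?rmorph1 ?rmorphD //.
by move=> n n_ge3; rewrite f_ge3 // rmorphD !rmorphM.
Qed.

Lemma nested_rec1_gt0 u (f : nat -> rat) n : nested_rec 1 1 u f -> 0 < f n.
Proof.
move=> [f0 f1 f2 f_ge3]; elim/ltn_ind: n => n IHn.
have [n_lt3|n_ge3] := ltnP n 3.
  by case: n n_lt3 {IHn} => [|[|[|]]] // _; rewrite ?f0 ?f1 ?f2.
by rewrite f_ge3 // !mul1r addr_gt0 // IHn //; lia.
Qed.

Lemma generic_neq0 u (f : nat -> {mpoly rat[2]}) n :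
  nested_rec 'X_ord0 'X_ord_max u f -> f n != 0.
Proof.
move/(nested_rec_morph (meval (fun=> 1))); rewrite /= !mevalXU.
move/(nested_rec1_gt0 n) => fn_gt0.
by apply: contraTneq fn_gt0 => ->; rewrite meval0 ltxx.
Qed.

(* The guard [c = 2 -> ~ Rset u 1] on the cardinality bound removes the only
   case in which the bound can fail: for c = 2 and u = 1,0,1,0,1,0,... one has
   Rset u = {0, 1, 3, 5, ...} and h takes the values 1, a + b and
   a + b / (a + b). *)
Theorem proposition4p2 (u : nat -> bool) (c : nat) (c_ge1 : (1 <= c)%N)
    (gaps : gaps_bounded c (Rset u)) :
  (forall (a b : int) (f : nat -> int),
     nested_rec a b u f ->
     (forall n : nat, f n != 0) ->
     let h : nat -> rat := fun n => (f n.+1)%:~R / (f n)%:~R in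
     ((c = 2%N -> ~ Rset u 1%N) -> range h #<= `I_(2 ^ (c - 1))%N) /\
     (forall k : nat, (2 <= k)%N -> automatic k u -> automatic k h)) /\
  (forall f : nat -> {mpoly rat[2]},
     nested_rec 'X_ord0 'X_ord_max u f ->
     let h : nat -> {fraction {mpoly rat[2]}} :=
       fun n => tofrac (f n.+1) / tofrac (f n) in
     ((c = 2%N -> ~ Rset u 1%N) -> range h #<= `I_(2 ^ (c - 1))%N) /\
     (forall k : nat, (2 <= k)%N -> automatic k u -> automatic k h)).
Proof.
split=> [a b f f_rec f_neq0 | f f_rec].
  apply: (@ratio_card_automatic rat a%:~R b%:~R u (fun n => (f n)%:~R)) => //.
    exact: (nested_rec_morph intr).
  by move=> n; rewrite intr_eq0.
apply: (@ratio_card_automatic _ (tofrac 'X_ord0) (tofrac 'X_ord_max) u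
  (fun n => tofrac (f n))) => //; first exact: (nested_rec_morph (@tofrac _)).
by move=> n; rewrite tofrac_eq0 (generic_neq0 _ f_rec).
Qed.
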